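(* Let $d\in\mathbb{C}$ with $d\ne0,-1,-2,\dots$, and let $n\in\mathbb{N}_0$. Then $$\sum_{k=0}^{n}\frac{1}{2^{2k}(k+1)}\binom{n}{2k}\binom{2k}{k}\frac{\binom{k+d}{k}}{\binom{k+d-1}{k}}=\frac1d\cdot\frac{n(n-1)+2d(2n+1)}{2^n(n+1)(n+2)}\binom{2n}{n}.$$
   Context: $\mathbb{N}_0=\{0,1,2,\dots\}$. By convention $\binom{n}{2k}=0$ when $2k>n$. The Pochhammer symbol is $(\alpha)_0=1$, $(\alpha)_m=\alpha(\alpha+1)\cdots(\alpha+m-1)$ for $m\ge1$. Binomial coefficients with non-integer upper entry are generalized binomial coefficients; explicitly, for $k\in\mathbb{N}_0$, $\binom{k+d}{k}=\frac{(d+1)_k}{k!}$ and $\binom{k+d-1}{k}=\frac{(d)_k}{k!}$. *)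

(* Defs.v *)
From HB Require Import structures.
From mathcomp Require Import all_boot all_order all_algebra.
From mathcomp Require Import complex.
From mathcomp Require Import reals.

Set Implicit Arguments.
Unset Strict Implicit.
Unset Printing Implicit Defensive.

Import GRing.Theory.

Local Open Scope ring_scope.

Definition pochhammer (F : fieldType) (a : F) (m : nat) : F :=
  \prod_(i < m) (a + i%:R).

(* The numerator is the falling product x (x - 1) ... (x - m + 1), read in
   increasing order as a Pochhammer symbol.  Division by m! is meaningful in
   characteristic 0 only. *)
Definition gbinom (F : fieldType) (x : F) (m : nat) : F :=
  pochhammer (x - m%:R + 1) m / (m`!)%:R.

Lemma gbinomD (F : fieldType) (d : F) (k : nat) :
  gbinom (k%:R + d) k = pochhammer (d + 1) k / (k`!)%:R.
Proof. by rewrite /gbinom [k%:R + d]addrC addrK. Qed.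

Lemma gbinomD1 (F : fieldType) (d : F) (k : nat) :
  gbinom (k%:R + d - 1) k = pochhammer d k / (k`!)%:R.
Proof. by rewrite /gbinom addrAC subrK [k%:R + d]addrC addrK. Qed.

(* Main.v *)
Require Import Defs.
From HB Require Import structures.
From mathcomp Require Import all_boot all_order all_algebra.
From mathcomp Require Import complex.
From mathcomp Require Import reals.
From mathcomp Require Import ring zify.

(** Since [(d + 1)_k / (d)_k = (d + k) / d = 1 + k / d], and since
[k / (k + 1)] times the central binomial coefficient ['C(2k, k)] is
['C(2k, k + 1)], the sum splits as [S0 + (1 / d - 1) S1] with
[Si = \sum_k 4^-k 'C(n, 2k) 'C(2k, k + i)], because
[(1 + k / d) / (k + 1) = 1 + (1 / d - 1) (k / (k + 1))].
Both sums come from one identity, [2^n Si = 'C(2n, n + 2i)]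
([sum_bin_double_shift]), obtained by reading off the coefficient of
['X^(n + 2i)] in [(1 + 'X)^(2n) = (2 'X + (1 + 'X^2))^n].
It remains to express ['C(2n, n + 2)] through ['C(2n, n)], by the ratio
[n (n - 1) / ((n + 1) (n + 2))]. *)

Set Implicit Arguments.
Unset Strict Implicit.
Unset Printing Implicit Defensive.

Import GRing.Theory.

Local Open Scope ring_scope.

Lemma coef_exp1X (R : comNzRingType) (n m : nat) :
  ((1 + 'X : {poly R}) ^+ n)`_m = 'C(n, m)%:R.
Proof.
rewrite exprDn coef_sum.
under eq_bigr => j _ do rewrite expr1n mul1r coefMn coefXn.
have [le_mn | lt_nm] := leqP m n.
  have lt_mn : (m < n.+1)%N by [].
  rewrite (bigD1 (Ordinal lt_mn)) //= eqxx big1 ?addr0 // => j ne_jm.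
  by rewrite eq_sym (negPf (ne_jm : (j : nat) != m)) mul0rn.
rewrite bin_small // big1 // => j _.
by rewrite gtn_eqF ?mul0rn // (leq_trans (ltn_ord j)).
Qed.

Lemma coef_exp1Xsqr (R : comNzRingType) (n m : nat) :
  ((1 + 'X^2 : {poly R}) ^+ n)`_m = if odd m then 0 else 'C(n, m./2)%:R.
Proof.
have -> : (1 + 'X^2 : {poly R}) ^+ n = ((1 + 'X) ^+ n) \Po 'X^2.
  by rewrite rmorphXn rmorphD rmorph1 /= comp_polyX.
rewrite coef_comp_poly_Xn // dvdn2 divn2 coef_exp1X.
by case: (odd m).
Qed.

Lemma sum_nat_even_odd (V : nmodType) (f : nat -> V) (m : nat) :
  \sum_(0 <= j < m.*2) f j = \sum_(0 <= k < m) (f k.*2 + f k.*2.+1).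
Proof.
elim: m => [|m IHm]; first by rewrite !big_geq.
by rewrite doubleS !big_nat_recr //= IHm addrA.
Qed.

(** Expanding [(2 'X + (1 + 'X^2)) ^ n], the term with [(1 + 'X^2) ^ j]
contributes [2 ^ (n - j) 'C(n, j)] times the coefficient of ['X^(j + 2 i)] in
[(1 + 'X^2) ^ j]; the latter vanishes unless [j] is even. *)
Lemma sum_bin_double_shift (R : comNzRingType) (n i : nat) :
  \sum_(0 <= k < n.+1) (2 ^+ (n - k.*2) * 'C(n, k.*2)%:R * 'C(k.*2, k + i)%:R)
  = 'C(n.*2, n + i.*2)%:R :> R.
Proof.
rewrite -coef_exp1X -mul2n exprM.
have -> : (1 + 'X : {poly R}) ^+ 2 = 2%:P * 'X + (1 + 'X^2).
  by rewrite polyCMn; ring.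
rewrite exprDn coef_sum.
pose f j : R := 2 ^+ (n - j) * 'C(n, j)%:R *
  (if odd j then 0 else 'C(j, (j + i.*2)./2)%:R).
transitivity (\sum_(0 <= j < n.+1) f j); last first.
  rewrite big_mkord; apply: eq_bigr => j _.
  rewrite coefMn exprMn -polyC_exp -mulrA coefCM mulrC coefXnM.
  have le_jn : (j <= n)%N by rewrite -ltnS.
  have -> : (n + i.*2 < n - j)%N = false by lia.
  have -> : (n + i.*2 - (n - j) = j + i.*2)%N by lia.
  rewrite coef_exp1Xsqr oddD odd_double addbF /f.
  by case: (odd j); rewrite -[RHS]mulr_natr; ring.
(* Extending the range from [n] to [2 n + 1] only adds terms in which
   ['C(n, j)] vanishes. *)
transitivity (\sum_(0 <= j < n.+1.*2) f j).
  rewrite sum_nat_even_odd; apply: eq_bigr => k _.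
  by rewrite /f /= odd_double /= mulr0 addr0 -doubleD doubleK.
rewrite (big_cat_nat (n := n.+1)) //=; last by lia.
rewrite [X in _ + X]big_nat [X in _ + X]big1 ?addr0 // => j /andP[lt_nj _].
by rewrite /f bin_small // mulr0 mul0r.
Qed.

(** Dividing by [2 ^ n] turns [2 ^ (n - 2 k)] into the [4 ^ - k] of the theorem;
the exponent is truncated only where ['C(n, 2 k)] vanishes. *)
Lemma sum_bin_double_shift_div (F : fieldType) (n i : nat) :
  2%:R != 0 :> F ->
  \sum_(0 <= k < n.+1) ('C(n, k.*2)%:R * 'C(k.*2, k + i)%:R / 2 ^+ k.*2)
  = 'C(n.*2, n + i.*2)%:R / 2 ^+ n :> F.
Proof.
move=> two_neq0; rewrite -sum_bin_double_shift mulr_suml.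
apply: eq_bigr => k _.
have [le_kn | lt_nk] := leqP k.*2 n; last first.
  by rewrite bin_small // mulr0 !mul0r.
have -> : 2 ^+ n = 2 ^+ (n - k.*2) * 2 ^+ k.*2 :> F by rewrite -exprD subnK.
by field; rewrite !expf_neq0.
Qed.

Lemma mul_bin_central_succ (k : nat) :
  (k.+1 * 'C(k.*2, k.+1) = k * 'C(k.*2, k))%N.
Proof. by rewrite mul_bin_left -addnn addnK. Qed.

Lemma mul_bin_central_succ2 (n : nat) :
  (n.+1 * n.+2 * 'C(n.*2, n.+2) = n * n.-1 * 'C(n.*2, n))%N.
Proof.
rewrite -mulnA mul_bin_left mulnCA mul_bin_central_succ mulnA.
by have -> : (n.*2 - n.+1 = n.-1)%N; [lia | rewrite [(n.-1 * n)%N]mulnC].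
Qed.

(** Both sides are the product [d (d + 1) ... (d + k)], split at its first or its
last factor. *)
Lemma pochhammer_shift (F : fieldType) (d : F) (k : nat) :
  d * pochhammer (d + 1) k = pochhammer d k * (d + k%:R).
Proof.
rewrite /pochhammer.
transitivity (\prod_(i < k.+1) (d + i%:R)); last exact: big_ord_recr.
rewrite big_ord_recl addr0; congr (_ * _).
by apply: eq_bigr => i _; rewrite -addrA -natr1 [i%:R + 1]addrC.
Qed.

Lemma pochhammer_neq0 (F : fieldType) (d : F) (k : nat) :
  (forall m : nat, d != - m%:R) -> pochhammer d k != 0.
Proof.
by move=> hd; apply/prodf_neq0 => i _; rewrite addr_eq0.
Qed.

Lemma gbinom_ratio (F : fieldType) (d : F) (k : nat) :
  (k`!)%:R != 0 :> F -> (forall m : nat, d != - m%:R) ->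
  gbinom (k%:R + d) k / gbinom (k%:R + d - 1) k = (d + k%:R) / d.
Proof.
move=> fact_neq0 hd; rewrite gbinomD gbinomD1.
have d_neq0 : d != 0 by have := hd 0; rewrite oppr0.
have poch_neq0 := pochhammer_neq0 k hd.
have -> : pochhammer (d + 1) k = pochhammer d k * (d + k%:R) / d.
  by rewrite -pochhammer_shift mulrC mulKf.
by field; rewrite d_neq0 poch_neq0 fact_neq0.
Qed.

Theorem theorem5p2 (R : realType) (d : R[i]) (n : nat)
    (hd : forall m : nat, d != - m%:R) :
  \sum_(0 <= k < n.+1)
     1 / (2 ^+ (2 * k) * (k%:R + 1)) * 'C(n, 2 * k)%:R * 'C(2 * k, k)%:R
       * (gbinom (k%:R + d) k / gbinom (k%:R + d - 1) k)
  = 1 / d * ((n%:R * (n%:R - 1) + 2 * d * (2 * n%:R + 1))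
             / (2 ^+ n * (n%:R + 1) * (n%:R + 2))) * 'C(2 * n, n)%:R.
Proof.
have natS_neq0 m : m.+1%:R != 0 :> R[i] by rewrite Num.Theory.pnatr_eq0.
have two_neq0 := natS_neq0 1%N.
have d_neq0 : d != 0 by have := hd 0; rewrite oppr0.
transitivity
  (\sum_(0 <= k < n.+1) ('C(n, k.*2)%:R * 'C(k.*2, k + 0)%:R / 2 ^+ k.*2) +
   (1 / d - 1) *
   \sum_(0 <= k < n.+1) ('C(n, k.*2)%:R * 'C(k.*2, k + 1)%:R / 2 ^+ k.*2)).
  rewrite mulr_sumr -big_split; apply: eq_bigr => k _ /=.
  rewrite gbinom_ratio //; last first.
    by rewrite Num.Theory.pnatr_eq0 -lt0n fact_gt0.
  rewrite mul2n addn0 addn1.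
  have k1_neq0 : k%:R + 1 != 0 :> R[i] by rewrite natr1.
  have -> : 'C(k.*2, k.+1)%:R = k%:R * 'C(k.*2, k)%:R / (k%:R + 1) :> R[i].
    by rewrite -natrM -mul_bin_central_succ natrM natr1 [_ * 'C(_, _)%:R]mulrC mulfK.
  have pow_neq0 : 2 ^+ k.*2 != 0 :> R[i] by rewrite expf_neq0.
  by field; rewrite d_neq0 k1_neq0 pow_neq0.
rewrite !sum_bin_double_shift_div // mul2n addn0 addn2.
have n1_neq0 : n%:R + 1 != 0 :> R[i] by rewrite natr1.
have n2_neq0 : n%:R + 2 != 0 :> R[i] by rewrite -natrD addn2.
have pow_neq0 : 2 ^+ n != 0 :> R[i] by rewrite expf_neq0.
have nat_pred : n%:R * n.-1%:R = n%:R * (n%:R - 1) :> R[i].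
  by case: n {n1_neq0 n2_neq0 pow_neq0} => [|m]; rewrite ?mul0r // -natr1 addrK.
have -> : 'C(n.*2, n.+2)%:R
    = n%:R * (n%:R - 1) * 'C(n.*2, n)%:R / ((n%:R + 1) * (n%:R + 2)) :> R[i].
  rewrite -nat_pred -!natrM -mul_bin_central_succ2 !natrM natr1 -natrD addn2.
  by rewrite [X in X / _]mulrC mulfK // mulf_neq0.
by field; rewrite d_neq0 n1_neq0 n2_neq0 pow_neq0.
Qed.
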